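(* Fix $K\ge1$. There exists $C_K<\infty$ (depending only on $K$) such that the following holds for every integer $m\ge5$. Let $Z_1,\ldots,Z_m$ be independent Steinhaus random variables and let $b_1,\ldots,b_m>0$ satisfy $$\frac{\max_jb_j}{\min_jb_j}\le K.$$ Set $S>0$ by $S^2=\sum_{j=1}^m b_j^2$. Then, uniformly for every $a\in\mathbb C$, $$\mathbb E\left(\log\left|a+\sum_{j=1}^m b_jZ_j\right|\right)\ge\log S-C_K.$$
   Context: A Steinhaus random variable is a random variable distributed according to normalized Haar measure (the uniform distribution) on the unit circle $\{z\in\mathbb C:|z|=1\}$. *)

(* Defs.v *)
From HB Require Import structures.
From mathcomp Require Import all_boot all_order all_algebra.
From mathcomp Require Import complex.
From mathcomp Require Import all_classical all_reals all_analysis.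
From mathcomp Require Import measurable_realfun ring lra.

Set Implicit Arguments.
Unset Strict Implicit.
Unset Printing Implicit Defensive.

Import Order.TTheory GRing.Theory Num.Theory.
Import numFieldNormedType.Exports.

Local Open Scope classical_set_scope.
Local Open Scope ring_scope.

(* The Borel sigma-algebra of the complex plane, transported from R * R along
   z |-> (Re z, Im z).  The instance makes {RV P >-> R[i]} the type of
   complex-valued random variables. *)

Section complex_measurable.
Context {R : realType}.

Definition complex_coords (z : R[i]) : R * R := (complex.Re z, complex.Im z).

HB.instance Definition _ := isPointed.Build R[i] 0.

Definition complex_measurable : set (set R[i]) :=
  preimage_set_system setT complex_coords measurable.

Let sigma_algebra_complex : sigma_algebra setT complex_measurable.
Proof.
exact/sigma_algebra_preimage/sigma_algebra_measurable.
Qed.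

Let cmeas0 : complex_measurable set0.
Proof. by case: sigma_algebra_complex. Qed.

Let cmeasC A : complex_measurable A -> complex_measurable (~` A).
Proof. by case: sigma_algebra_complex => _ + _ => /[apply]; rewrite setTD. Qed.

Let cmeasU (F : (set R[i])^nat) : (forall n, complex_measurable (F n)) ->
  complex_measurable (\bigcup_n F n).
Proof. by case: sigma_algebra_complex => _ _; exact. Qed.

Fact complex_display : measure_display. Proof. exact: default_measure_display. Qed.

HB.instance Definition _ := @isMeasurable.Build complex_display R[i]
  complex_measurable cmeas0 cmeasC cmeasU.

End complex_measurable.

Section steinhaus.
Context {R : realType}.

Definition expi (t : measurableTypeR R) : R[i] := Complex (cos t) (sin t).

Lemma measurable_expi : measurable_fun setT expi.
Proof.
move=> _ A [B mB] <-; rewrite !setTI.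
have mcs : measurable_fun setT (fun t : R => (cos t, sin t)).
  apply: measurable_fun_pair; apply: continuous_measurable_fun.
    exact: continuous_cos.
  exact: continuous_sin.
by rewrite -[X in measurable X]setTI; exact: mcs.
Qed.

HB.instance Definition _ :=
  isMeasurableFun.Build _ _ _ _ expi measurable_expi.

Lemma two_pi_gt0 : 0 < 2 * pi :> R.
Proof. by rewrite mulr_gt0 ?pi_gt0. Qed.

(* Normalized arc length on the unit circle, as a Borel probability on the
   whole plane: the image of the uniform law on [0, 2 * pi] under expi.
   By haar_circle_support and haar_circle_rot below it is carried by the circle
   and rotation invariant, i.e. it is the normalized Haar measure. *)
Definition haar_circle : probability R[i] R :=
  distribution (uniform_prob two_pi_gt0) expi.

Local Notation mu := (@lebesgue_measure R).

Lemma lebesgue_measure_shift (c : R) (A : set R) : measurable A ->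
  mu ((fun x => x + c) @^-1` A) = mu A.
Proof.
move=> mA.
have ms : measurable_fun setT (fun x : measurableTypeR R => (x + c) : measurableTypeR R).
  exact: measurable_funD.
pose h0 := fun x : measurableTypeR R => (x + c) : measurableTypeR R.
pose m0 := isMeasurableFun.Build _ _ _ _ h0 ms.
pose h : {mfun measurableTypeR R >-> measurableTypeR R} := HB.pack h0 m0.
rewrite -[LHS]/(pushforward mu h A); apply/esym.
apply: lebesgue_measure_unique => // X [[a b] _ <-] /=.
rewrite /pushforward.
have -> : h @^-1` `]a, b]%classic = `]a - c, b - c]%classic.
  by apply/seteqP; split => x /=; rewrite !in_itv/= ltrBlDr lerBrDr.
by rewrite !lebesgue_measure_itv/= !lte_fin ltrD2r -!EFinD; case: ifP => // _; congr EFin; ring.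
Qed.

Lemma measurable_preimage_expi (A : set R[i]) : measurable A -> measurable (expi @^-1` A : set R).
Proof. by move=> mA; rewrite -[X in measurable X]setTI; exact: measurable_expi. Qed.

Lemma haar_circleE (A : set R[i]) : measurable A ->
  haar_circle A = ((2 * pi)^-1%:E * mu (`]0%R, (2 * pi)%R] `&` expi @^-1` A))%E.
Proof.
move=> mA; have mU := measurable_preimage_expi mA.
rewrite -[LHS]/(uniform_prob two_pi_gt0 (expi @^-1` A)) /uniform_prob integral_uniform_pdf.
rewrite (eq_integral (fun=> ((2 * pi)^-1)%:E)); last first.
  by move=> x; rewrite inE => -[_ /=]; rewrite in_itv /uniform_pdf /= => ->; rewrite subr0.
rewrite integral_cst/=; last exact: measurableI.
congr (_ * _)%E; rewrite setIC -(@setU1itv _ _ (BRight (2 * pi)) 0 false) ?bnd_simp; last first.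
  by rewrite ltW// two_pi_gt0.
rewrite setIUl setUC.
apply: measureU0; [exact: measurableI|exact: measurableI|].
apply/eqP; rewrite -measure_le0 -(lebesgue_measure_set1 (0:R)).
by apply: le_measure; rewrite ?inE//; exact: measurableI.
Qed.

Lemma expiD (s t : R) : expi (s + t) = expi s * expi t.
Proof. by rewrite /expi cosD sinD; congr Complex; rewrite addrC [X in X + _]mulrC. Qed.

Lemma expi2pi (t : R) : expi (t + 2 * pi) = expi t.
Proof. by rewrite /expi mulr_natl cosD2pi sinD2pi. Qed.

Lemma normc_expi (t : R) : Normc.normc (expi t) = 1.
Proof. by rewrite /= cos2Dsin2 sqrtr1. Qed.

Lemma expi_arg (u : R[i]) : Normc.normc u = 1 ->
  exists2 t : R, 0 <= t <= 2 * pi & u = expi t.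
Proof.
case: u => a b /= h.
have h2 : a ^+ 2 + b ^+ 2 = 1.
  by rewrite -[LHS]sqr_sqrtr ?h ?expr1n// addr_ge0 ?sqr_ge0.
have a1 : -1 <= a <= 1 by have := sqr_ge0 b; nra.
have [a0 ap] := (acos_ge0 a1, acos_lepi a1).
have sE : sin (acos a) = `|b|.
  by rewrite sin_acos// -sqrtr_sqr; congr Num.sqrt; lra.
have cE : cos (acos a) = a by rewrite acosK.
have [b0|b0] := leP 0 b.
  exists (acos a); last by rewrite /expi cE sE ger0_norm.
  by have := pi_gt0 R; lra.
exists (- acos a + 2 * pi); first by have := pi_gt0 R; lra.
by rewrite expi2pi /expi cosN sinN cE sE ltr0_norm// opprK.
Qed.

Lemma haar_circle_support : haar_circle [set z : R[i] | Normc.normc z = 1] = 1%E.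
Proof.
rewrite -[LHS]/(uniform_prob two_pi_gt0 (expi @^-1` [set z : R[i] | Normc.normc z = 1])).
rewrite (_ : _ @^-1` _ = setT) ?probability_setT//.
by apply/seteqP; split => // t _; exact: normc_expi.
Qed.

Lemma measurable_preimage_mulc (u : R[i]) (A : set R[i]) :
  measurable A -> measurable [set z | A (u * z)].
Proof.
case: u => a b [B mB <-]; rewrite setTI.
have mg : measurable_fun setT
    (fun p : R * R => (a * p.1 - b * p.2, a * p.2 + b * p.1)).
  by apply: measurable_fun_pair; [apply: measurable_funB|apply: measurable_funD];
    apply: measurable_funM => //; exact: measurable_cst.
exists ((fun p : R * R => (a * p.1 - b * p.2, a * p.2 + b * p.1)) @^-1` B).
  by rewrite -[X in measurable X]setTI; exact: mg.
by rewrite setTI; apply/seteqP; split => -[x y].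
Qed.

Lemma haar_circle_rot (u : R[i]) (A : set R[i]) : Normc.normc u = 1 ->
  measurable A ->
  haar_circle [set z | A (u * z)] = haar_circle A.
Proof.
move=> /expi_arg[t /andP[t0 t2] ->] mA.
have mA' := measurable_preimage_mulc (expi t) mA.
rewrite !haar_circleE//; congr (_ * _)%E.
set B := expi @^-1` A.
have mB : measurable (B : set R) by exact: measurable_preimage_expi.
rewrite (_ : _ `&` _ =
    (fun x => x + t) @^-1` (`]t, (t + 2 * pi)%R] `&` B)); last first.
  apply/seteqP; split => x /=; rewrite !in_itv/= /B /= addrC expiD => -[+ ?]; split => //; lra.
rewrite lebesgue_measure_shift; last exact: measurableI.
rewrite (@itv_bndbnd_setU _ _ (BRight t) (BRight (2 * pi)) (BRight (t + 2 * pi))) ?bnd_simp//; last lra.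
rewrite (@itv_bndbnd_setU _ _ (BRight 0) (BRight t) (BRight (2 * pi))) ?bnd_simp//.
rewrite !setIUl !measureU//=; try exact: measurableI; last 2 first.
- by apply/seteqP; split => x //= [] []; rewrite !in_itv/= => ? _ []; lra.
- by apply/seteqP; split => x //= [] []; rewrite !in_itv/= => ? _ []; lra.
rewrite addeC; congr (_ + _)%E.
rewrite -(lebesgue_measure_shift (2 * pi)); last exact: measurableI.
congr (mu _); apply/seteqP; split => x /=; rewrite !in_itv/= /B /= expi2pi => -[+ ?]; split => //; lra.
Qed.

Definition steinhaus d (T : measurableType d) (P : probability T R)
    (Z : {RV P >-> R[i]}) : Prop :=
  forall A : set R[i], measurable A -> distribution P Z A = haar_circle A.

End steinhaus.

Definition mutually_independent (R : realType) d (T : measurableType d)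
    (P : probability T R) d' (E : measurableType d') (I : finType)
    (X : I -> {RV P >-> E}) : Prop :=
  forall (J : {set I}) (A : I -> set E),
    (forall j, j \in J -> measurable (A j)) ->
    P (\bigcap_(j in [set` J]) (X j @^-1` A j)) =
    (\prod_(j in J) P (X j @^-1` A j))%E.

(* The seed values 0 and max_entry b have no effect when b is nonempty with
   nonnegative entries. *)
Definition max_entry (R : realType) (m : nat) (b : 'I_m -> R) : R :=
  \big[Num.max/0]_(j < m) b j.

Definition min_entry (R : realType) (m : nat) (b : 'I_m -> R) : R :=
  \big[Num.min/max_entry b]_(j < m) b j.

Lemma max_entry_spec (R : realType) m (b : 'I_m -> R) :
  (0 < m)%N -> (forall j, 0 <= b j) ->
  (exists j, max_entry b = b j) /\ forall j, b j <= max_entry b.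
Proof.
move=> m0 b0; split; last by move=> j; exact: le_bigmax.
eexists; exact: (@bigmax_eq_arg _ _ _ 0 (Ordinal m0)).
Qed.

Lemma min_entry_spec (R : realType) m (b : 'I_m -> R) :
  (0 < m)%N -> (forall j, 0 <= b j) ->
  (exists j, min_entry b = b j) /\ forall j, min_entry b <= b j.
Proof.
move=> m0 b0; have [_ bm] := max_entry_spec m0 b0.
split; last by move=> j; exact: bigmin_le_cond.
eexists; exact: (@bigmin_eq_arg _ _ _ (max_entry b) (Ordinal m0)).
Qed.

(* Main.v *)
Require Import Defs.
From HB Require Import structures.
From mathcomp Require Import all_boot all_order all_algebra.
From mathcomp Require Import complex.
From mathcomp Require Import all_classical all_reals all_analysis.
From mathcomp Require Import measurable_realfun ring lra zify.

(** The expectation of ln |X| for a sum X of many independent rotation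
invariant variables is bounded below by a contraction argument.

Let f_r (z) = (ln r - ln |z|)^+ denote the deficit of |z| below the scale r,
let X, Y be independent, X isotropic, with variances s^2 and t^2, and let
r^2 = s^2 + t^2.

- Rotating X by a uniform u and averaging, Jensen's formula for the mean of
  ln |u x + y| over the circle shows that the expected deficit of X + Y is at
  most that of max |X| |Y|, up to ln 2 (isotropic_log_deficitD).  The weak form
  of Jensen's formula used here (circle_deficit_le) follows from
  p^2 - q^2 = (p - q) (p + q) and the invariance of the circle under rotation.

- If Y also satisfies E |Y|^4 <= 2 t^4, then |Y|^2 < t^2 / 2 has probability
  at most 4 / 5 (Paley-Zygmund, integral_small_ball_weight).  Outside this
  event the maximum has a bounded deficit when r and t are comparable; on it
  the deficit of the maximum is at most that of X, which is independent of the
  event.  Hence a bound D for the expected deficit of X gives the bound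
  c + 4 / 5 (D + c) for X + Y, where c depends only on r / s and r / t
  (expected_log_deficitD).

A weighted sum of Steinhaus variables with weights of ratio at most K splits
into two halves whose variances are comparable to the total variance, up to a
factor 3 K^2.  By induction on the number of terms every such sum has expected
deficit at most a constant depending only on K, namely a D with
c + 4 / 5 (D + c) <= D (partial_sum_deficit).  Finally the constant a plays
the role of Y in the first step: max |X| |a| has at most the deficit of X, so
the bound is uniform in a. *)

Set Implicit Arguments.
Unset Strict Implicit.
Unset Printing Implicit Defensive.

Import Order.TTheory GRing.Theory Num.Theory.
Import numFieldNormedType.Exports.

Local Open Scope classical_set_scope.
Local Open Scope ring_scope.
Local Open Scope complex_scope.

(** * Measurability and modulus in the complex plane *)

Section complex_plane.
Context {R : realType}.
Implicit Types (z u v w : R[i]).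

Lemma measurable_coords : measurable_fun setT (@complex_coords R).
Proof. by move=> _ B mB; rewrite setTI; exists B => //; rewrite setTI. Qed.

Lemma measurable_Re : measurable_fun setT (@complex.Re R : R[i] -> R).
Proof. exact: (measurableT_comp measurable_fst measurable_coords). Qed.

Lemma measurable_Im : measurable_fun setT (@complex.Im R : R[i] -> R).
Proof. exact: (measurableT_comp measurable_snd measurable_coords). Qed.

Section into_complex.
Context d (T : measurableType d).
Implicit Types f g : T -> R[i].

Lemma measurable_fun_complex f :
  measurable_fun setT (fun x => complex.Re (f x)) ->
  measurable_fun setT (fun x => complex.Im (f x)) -> measurable_fun setT f.
Proof.
move=> mr mi _ _ [B mB <-]; rewrite !setTI.
have := measurable_fun_pair mr mi.
by move=> /(_ measurableT B mB); rewrite setTI.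
Qed.

Lemma measurable_complexD f g : measurable_fun setT f ->
  measurable_fun setT g -> measurable_fun setT (fun x => f x + g x).
Proof.
move=> mf mg; apply: measurable_fun_complex.
- apply: (eq_measurable_fun (fun x => complex.Re (f x) + complex.Re (g x))).
    by move=> x _; case: (f x) (g x) => [? ?] [].
  by apply: measurable_funD; exact: (measurableT_comp measurable_Re).
- apply: (eq_measurable_fun (fun x => complex.Im (f x) + complex.Im (g x))).
    by move=> x _; case: (f x) (g x) => [? ?] [].
  by apply: measurable_funD; exact: (measurableT_comp measurable_Im).
Qed.

Lemma measurable_complexM f g : measurable_fun setT f ->
  measurable_fun setT g -> measurable_fun setT (fun x => f x * g x).
Proof.
move=> mf mg.
have [mRf mIf] := (measurableT_comp measurable_Re mf, measurableT_comp measurable_Im mf).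
have [mRg mIg] := (measurableT_comp measurable_Re mg, measurableT_comp measurable_Im mg).
apply: measurable_fun_complex.
- apply: (eq_measurable_fun (fun x => complex.Re (f x) * complex.Re (g x)
     - complex.Im (f x) * complex.Im (g x))).
    by move=> x _; case: (f x) (g x) => [? ?] [].
  by apply: measurable_funB; apply: measurable_funM.
- apply: (eq_measurable_fun (fun x => complex.Re (f x) * complex.Im (g x)
     + complex.Im (f x) * complex.Re (g x))).
    by move=> x _; case: (f x) (g x) => [? ?] [].
  by apply: measurable_funD; apply: measurable_funM.
Qed.

Lemma measurable_complexX f n : measurable_fun setT f ->
  measurable_fun setT (fun x => f x ^+ n).
Proof.
move=> mf; elim: n => [|n ih].
  by under eq_fun do rewrite expr0; exact: measurable_cst.
apply: (eq_measurable_fun (fun x => f x * f x ^+ n)).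
  by move=> x _; rewrite exprS.
exact: measurable_complexM.
Qed.

Lemma measurable_normc f : measurable_fun setT f ->
  measurable_fun setT (fun x => Normc.normc (f x)).
Proof.
move=> mf.
have [mRf mIf] := (measurableT_comp measurable_Re mf, measurableT_comp measurable_Im mf).
apply: (eq_measurable_fun (fun x => Num.sqrt
    (complex.Re (f x) ^+ 2 + complex.Im (f x) ^+ 2))).
  by move=> x _; case: (f x).
apply: (measurableT_comp (continuous_measurable_fun _)); first exact: sqrt_continuous.
by apply: measurable_funD; apply: measurable_funX.
Qed.

End into_complex.

Lemma normc_ge0 z : 0 <= Normc.normc z.
Proof. by case: z => a b; exact: sqrtr_ge0. Qed.

Lemma normc_gt0 z : (0 < Normc.normc z) = (z != 0).
Proof.
rewrite lt_def normc_ge0 andbT; congr (~~ _).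
by apply/eqP/eqP => [/Normc.eq0_normc//|->]; exact: Normc.normc0.
Qed.

Lemma normcX z n : Normc.normc (z ^+ n) = Normc.normc z ^+ n.
Proof.
elim: n => [|n ih]; first by rewrite !expr0 Normc.normc1.
by rewrite !exprS Normc.normcM ih.
Qed.

Lemma sqr_normcE z : Normc.normc z ^+ 2 = complex.Re z ^+ 2 + complex.Im z ^+ 2.
Proof. by case: z => a b /=; rewrite sqr_sqrtr// addr_ge0 ?sqr_ge0. Qed.

Lemma normc_real (b : R) : 0 <= b -> Normc.normc b%:C = b.
Proof. by move=> b0; rewrite /= expr0n/= addr0 sqrtr_sqr ger0_norm. Qed.

End complex_plane.

(** * The logarithmic deficit *)

Section log_deficit.
Context {R : realType}.
Implicit Types r s t : R.

(** The quantity (ln r - ln t)^+, with value +oo at t = 0.  A lower bound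
for the expectation of ln |X| reduces to an upper bound for the expectation
of this nonnegative function, to which Tonelli applies without any
integrability condition. *)
Definition log_deficit r t : \bar R := maxe 0%E ((ln r)%:E - lne t%:E)%E.

Lemma log_deficit_ge0 r t : (0 <= log_deficit r t)%E.
Proof. by rewrite /log_deficit le_max lexx. Qed.

Lemma log_deficit_le0 r t : t <= 0 -> log_deficit r t = +oo%E.
Proof. by move=> t0; rewrite /log_deficit le0_lneNy ?lee_fin//= maxey. Qed.

Lemma log_deficitE r t : 0 < t ->
  log_deficit r t = (Num.max 0 (ln r - ln t))%:E.
Proof. by move=> t0; rewrite /log_deficit lne_EFin// -EFinB -EFin_max. Qed.

Lemma le_log_deficit r s t : s <= t -> (log_deficit r t <= log_deficit r s)%E.
Proof.
move=> st; have [s0|s0] := leP s 0; first by rewrite (log_deficit_le0 r s0) leey.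
have t0 := lt_le_trans s0 st.
rewrite !log_deficitE// lee_fin ge_max le_max lexx/= le_max; apply/orP; right.
by rewrite lerD2l lerN2 ler_ln.
Qed.

Lemma log_deficit_eq0 r t : 0 < r -> r <= t -> log_deficit r t = 0%E.
Proof.
move=> r0 rt; have t0 := lt_le_trans r0 rt.
by rewrite log_deficitE// max_l// subr_le0 ler_ln.
Qed.

Lemma log_deficitM c r t : 0 < c -> 0 < r ->
  log_deficit (c * r) (c * t) = log_deficit r t.
Proof.
move=> c0 r0; have [t0|t0] := leP t 0.
  by rewrite !log_deficit_le0// pmulr_rle0.
rewrite !log_deficitE ?mulr_gt0// !lnM ?posrE//; congr (Num.max _ _)%:E; ring.
Qed.

Lemma log_deficit_change r s t :
  (log_deficit r t <= log_deficit s t + (Num.max 0 (ln r - ln s))%:E)%E.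
Proof.
have [t0|t0] := leP t 0; first by rewrite !log_deficit_le0.
rewrite !log_deficitE// -EFinD lee_fin.
by rewrite /Num.max; do ![case: ifPn]; rewrite -?leNgt; lra.
Qed.

Lemma measurable_log_deficit r : measurable_fun setT (log_deficit r).
Proof.
apply: (eq_measurable_fun (fun t => if t <= 0 then +oo%E
    else (Num.max 0 (ln r - ln t))%:E)).
  move=> t _; case: ifPn => [/log_deficit_le0->//|].
  by rewrite -ltNge => /log_deficitE ->.
apply: measurable_fun_ifT => //.
- by apply: measurable_fun_ler.
- apply/measurable_EFinP; apply: measurable_maxr => //.
  by apply: measurable_funB => //; exact: measurable_ln.
Qed.

Lemma lne_ge_log_deficit r t : 0 < r ->
  ((ln r)%:E - log_deficit r t <= lne t%:E)%E.
Proof.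
move=> r0; have [t0|t0] := leP t 0; first by rewrite log_deficit_le0//= leNye.
rewrite log_deficitE// lne_EFin// -EFinB lee_fin.
by rewrite /Num.max; case: ifPn; rewrite -?leNgt; lra.
Qed.

(** A bounded version of log_deficit 1, increasing to it as M tends to
infinity: the iteration on the circle below needs a finite starting bound. *)
Definition truncated_deficit (M t : R) : R :=
  Num.max 0 (- ln (Num.max t (expR (- M)))).

Lemma truncated_deficit_ge0 M t : 0 <= truncated_deficit M t.
Proof. by rewrite le_max lexx. Qed.

Let trunc_gt0 M t : 0 < Num.max t (expR (- M)).
Proof. by rewrite lt_max expR_gt0 orbT. Qed.

Lemma truncated_deficit_le M t : 0 <= M -> truncated_deficit M t <= M.
Proof.
move=> M0; rewrite ge_max M0/= lerNl -{1}(expRK (- M)).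
by rewrite ler_ln ?posrE ?expR_gt0 ?trunc_gt0// le_max lexx orbT.
Qed.

Lemma truncated_deficit_eq0 M t : 1 <= t -> truncated_deficit M t = 0.
Proof.
move=> t1; apply/max_l; rewrite oppr_le0 ln_ge0//.
by rewrite le_max t1.
Qed.

Lemma truncated_deficit_double M s t : s <= 2 * t ->
  truncated_deficit M t <= ln 2 + truncated_deficit M s.
Proof.
move=> st; have l2 : 0 <= ln 2 :> R by rewrite ln_ge0// ler1n.
rewrite ge_max addr_ge0 ?truncated_deficit_ge0//=.
apply: (@le_trans _ _ (ln 2 - ln (Num.max s (expR (- M))))); last first.
  by rewrite lerD2l le_max lexx orbT.
rewrite lerBrDr addrC lerBlDr -lnM ?posrE// ler_ln ?posrE ?mulr_gt0//.
have := expR_gt0 (- M); rewrite ge_max => e0; apply/andP; split.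
  by apply: le_trans st _; rewrite ler_pM2l// le_max lexx.
apply: (@le_trans _ _ (2 * expR (- M))); first by lra.
by rewrite ler_pM2l// le_max lexx orbT.
Qed.

Lemma measurable_truncated_deficit M :
  measurable_fun setT (truncated_deficit M).
Proof.
apply: measurable_maxr => //; apply: measurable_funN.
apply: (measurableT_comp (@measurable_ln R)).
exact: measurable_maxr.
Qed.

Lemma truncated_deficit_homo t :
  {homo truncated_deficit ^~ t : M N / M <= N}.
Proof.
move=> M N MN; rewrite ge_max truncated_deficit_ge0/= le_max; apply/orP; right.
rewrite lerN2 ler_ln ?posrE// ge_max le_max lexx/= le_max; apply/orP; right.
by rewrite ler_expR lerN2.
Qed.

Lemma truncated_deficit_lim t :
  limn (fun n => (truncated_deficit n%:R t)%:E) = log_deficit 1 t.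
Proof.
apply/cvg_lim => //; have [t0|t0] := leP t 0.
  rewrite log_deficit_le0//.
  apply: (@cvg_trans _ (((n%:R : R)%:E) @[n --> \oo])); last exact/cvgeryP/cvgr_idn.
  apply: near_eq_cvg; near=> n.
  rewrite /truncated_deficit (@max_r _ _ t) ?(le_trans t0) ?expR_ge0//.
  by rewrite expRK opprK max_r.
rewrite log_deficitE// ln1 sub0r.
apply: cvg_near_cst; near=> n.
rewrite /truncated_deficit [X in ln X]max_l//.
rewrite -[leRHS]lnK ?posrE// ler_expR lerNl.
near: n; exact: nbhs_infty_ger.
Unshelve. all: by end_near. Qed.

End log_deficit.

(** * Averages over the unit circle *)

Section circle_average.
Context {R : realType}.
Implicit Types (p q u v w : R[i]) (F G : R[i] -> \bar R).

Lemma ge0_integral_haar_rot u F : Normc.normc u = 1 ->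
  measurable_fun setT F -> (forall z, 0 <= F z)%E ->
  (\int[haar_circle]_z F (u * z)%R = \int[haar_circle]_z F z)%E.
Proof.
move=> u1 mF F0.
have mu : measurable_fun setT (fun z => u * z).
  by apply: measurable_complexM => //; exact: measurable_cst.
rewrite -[LHS]/(\int[haar_circle]_(z in (fun z => u * z)%R @^-1` setT)
  (F \o (fun z => u * z)%R) z)%E.
rewrite -(ge0_integral_pushforward mu)//.
by apply: eq_measure_integral => A mA _; exact: haar_circle_rot.
Qed.

Lemma ge0_le_integral_haar F G :
  measurable_fun setT F -> (forall z, 0 <= F z)%E ->
  measurable_fun setT G -> (forall z, 0 <= G z)%E ->
  (forall u, Normc.normc u = 1 -> (F u <= G u)%E) ->
  (\int[haar_circle]_u F u <= \int[haar_circle]_u G u)%E.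
Proof.
move=> mF F0 mG G0 FG; rewrite !ge0_integral_distribution//.
apply: ge0_le_integral => //.
- by move=> t _; exact: F0.
- exact: measurableT_comp.
- exact: measurableT_comp.
- by move=> t _; apply: FG; exact: normc_expi.
Qed.

Lemma expiX (t : R) n : expi t ^+ n = expi (t *+ n).
Proof.
elim: n => [|n ih]; first by rewrite mulr0n /expi cos0 sin0.
by rewrite exprS ih -expiD mulrS.
Qed.

(** Rotating u by such a w exchanges p u^n - q and - (p u^n + q), so these
two have the same law when u is uniform on the circle. *)
Lemma exists_root_Nunit n : (0 < n)%N ->
  exists2 w : R[i], Normc.normc w = 1 & w ^+ n = -1.
Proof.
move=> n0; exists (expi (pi / n%:R)); first exact: normc_expi.
rewrite expiX -(mulr_natr (pi / _)) divfK ?pnatr_eq0 -?lt0n// /expi cospi sinpi.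
by apply/eqP; rewrite eq_complex/= oppr0 !eqxx.
Qed.

(** The two factors of p^2 - q^2 have moduli at most 2 and sum of moduli at
least 2.  One of them has modulus at least 1, hence no deficit; the other has
modulus at least |p^2 - q^2| / 2. *)
Lemma truncated_deficit_factor M p q :
  Normc.normc p <= 1 -> Normc.normc q <= 1 ->
  (Normc.normc p = 1 \/ Normc.normc q = 1) ->
  truncated_deficit M (Normc.normc (p - q)) +
    truncated_deficit M (Normc.normc (p + q)) <=
  ln 2 + truncated_deficit M (Normc.normc (p ^+ 2 - q ^+ 2)).
Proof.
move=> p1 q1 pq1.
have qN : Normc.normc (- q) = Normc.normc q := normcN q.
have dD : Normc.normc (p + q) <= 2.
  by apply: le_trans (le_normcD p q) _; rewrite -natr1 lerD.
have dB : Normc.normc (p - q) <= 2.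
  by apply: le_trans (le_normcD p (- q)) _; rewrite qN -natr1 lerD.
have d2 : 2 <= Normc.normc (p - q) + Normc.normc (p + q).
  have [e|e] := pq1.
  - have := le_normcD (p - q) (p + q).
    by rewrite addrACA addNr addr0 -mulr2n normcMn e.
  - have := le_normcD (- (p - q)) (p + q).
    by rewrite (normcN (p - q : R[i])) opprB addrA subrK -mulr2n normcMn e.
have E : Normc.normc (p ^+ 2 - q ^+ 2) =
    Normc.normc (p - q) * Normc.normc (p + q).
  by rewrite subr_sqr Normc.normcM.
have nB := normc_ge0 (p - q); have nD := normc_ge0 (p + q).
have [h|h] := leP 1 (Normc.normc (p + q)).
- rewrite (truncated_deficit_eq0 _ h) addr0; apply: truncated_deficit_double.
  by rewrite E mulrC ler_wpM2r.
- have h' : 1 <= Normc.normc (p - q) by lra.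
  rewrite (truncated_deficit_eq0 _ h') add0r; apply: truncated_deficit_double.
  by rewrite E ler_wpM2r.
Qed.

Let circle_mean M n p q : \bar R := (\int[haar_circle]_u
  (truncated_deficit M (Normc.normc (p * u ^+ n - q)%R))%:E)%E.

Let measurable_truncated M (f : R[i] -> R[i]) : measurable_fun setT f ->
  measurable_fun setT
    (fun u => (truncated_deficit M (Normc.normc (f u)))%:E).
Proof.
move=> mf; apply/measurable_EFinP.
apply: (measurableT_comp (@measurable_truncated_deficit R M)).
exact: measurable_normc.
Qed.

Let measurable_affine n p q : measurable_fun setT (fun u => p * u ^+ n + q).
Proof.
apply: measurable_complexD; last exact: measurable_cst.
apply: measurable_complexM; first exact: measurable_cst.
exact: measurable_complexX.
Qed.

Let integral_haar_cst (c : R) : (\int[@haar_circle R]_u c%:E = c%:E)%E.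
Proof. by rewrite integral_cst//= probability_setT mule1. Qed.

Let circle_mean_le M n p q : 0 <= M -> (circle_mean M n p q <= M%:E)%E.
Proof.
move=> M0; rewrite -[leRHS]integral_haar_cst; apply: ge0_le_integral => //.
- by move=> z _; rewrite lee_fin truncated_deficit_ge0.
- exact: measurable_truncated.
- by move=> z _; rewrite lee_fin truncated_deficit_le.
Qed.

Let circle_mean_fin M n p q : 0 <= M -> circle_mean M n p q \is a fin_num.
Proof.
move=> M0; rewrite ge0_fin_numE; last first.
  by apply: integral_ge0 => z _; rewrite lee_fin truncated_deficit_ge0.
exact: le_lt_trans (circle_mean_le n p q M0) (ltry _).
Qed.

(** Averaging over the rotation by an n-th root of -1, then factoring. *)
Let circle_mean_double M n p q : (0 < n)%N -> 0 <= M ->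
  Normc.normc p <= 1 -> Normc.normc q <= 1 ->
  (Normc.normc p = 1 \/ Normc.normc q = 1) ->
  (circle_mean M n p q + circle_mean M n p q <=
   (ln 2)%:E + circle_mean M (2 * n)%N (p ^+ 2)%R (q ^+ 2)%R)%E.
Proof.
move=> n0 M0 p1 q1 pq1.
have [w w1 wn] := exists_root_Nunit n0.
have tr0 (f : R[i] -> R[i]) (u : R[i]) : (0 <= (truncated_deficit M (Normc.normc (f u)))%:E)%E.
  by rewrite lee_fin truncated_deficit_ge0.
have -> : (circle_mean M n p q + circle_mean M n p q = \int[haar_circle]_u
    ((truncated_deficit M (Normc.normc (p * u ^+ n - q)%R))%:E +
     (truncated_deficit M (Normc.normc (p * u ^+ n + q)%R))%:E))%E.
  rewrite ge0_integralD//; [|exact: measurable_truncated..].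
  congr (_ + _)%E; rewrite /circle_mean -(ge0_integral_haar_rot w1)//; last first.
    exact: measurable_truncated.
  apply: eq_integral => u _; rewrite exprMn wn mulN1r mulrN -opprD.
  by rewrite (normcN (_ + _ : R[i])).
rewrite -(integral_haar_cst (ln 2)) -ge0_integralD//; last 2 first.
- by move=> x _; rewrite lee_fin ln_ge0// ler1n.
- exact: measurable_truncated.
apply: ge0_le_integral_haar.
- by apply: emeasurable_funD; exact: measurable_truncated.
- by move=> u; rewrite adde_ge0.
- by apply: emeasurable_funD => //; exact: measurable_truncated.
- by move=> u; rewrite adde_ge0// lee_fin ln_ge0// ler1n.
- move=> u u1; rewrite -!EFinD lee_fin mulnC exprM -exprMn.
  apply: truncated_deficit_factor => //; rewrite Normc.normcM normcX u1 expr1n mulr1//.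
Qed.

(** Each use of circle_mean_double halves the a priori bound M and the
constants ln 2 / 2 + ln 2 / 4 + ... add up to at most ln 2. *)
Let circle_mean_iter M n p q k : (0 < n)%N -> 0 <= M ->
  Normc.normc p <= 1 -> Normc.normc q <= 1 ->
  (Normc.normc p = 1 \/ Normc.normc q = 1) ->
  (circle_mean M n p q <= (ln 2 + M / 2 ^+ k)%R%:E)%E.
Proof.
move=> + M0; elim: k n p q => [|k ih] n p q n0 p1 q1 pq1.
  apply: le_trans (circle_mean_le n p q M0) _.
  by rewrite expr0 divr1 lee_fin lerDr ln_ge0// ler1n.
have := circle_mean_double n0 M0 p1 q1 pq1.
have : (circle_mean M (2 * n)%N (p ^+ 2)%R (q ^+ 2)%R <= (ln 2 + M / 2 ^+ k)%R%:E)%E.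
  apply: ih; rewrite ?muln_gt0// ?normcX ?exprn_ile1 ?normc_ge0//.
  by case: pq1 => ->; rewrite expr1n; [left|right].
rewrite -(fineK (circle_mean_fin n p q M0)).
rewrite -(fineK (circle_mean_fin (2 * n) (p ^+ 2) (q ^+ 2) M0)).
have -> : M / 2 ^+ k.+1 = M / 2 ^+ k / 2 by rewrite exprSr invfM mulrA.
rewrite -!EFinD !lee_fin; lra.
Qed.

Let circle_mean_le_ln2 M p q : 0 <= M ->
  Normc.normc p <= 1 -> Normc.normc q <= 1 ->
  (Normc.normc p = 1 \/ Normc.normc q = 1) ->
  (circle_mean M 1 p q <= (ln 2)%:E)%E.
Proof.
move=> M0 p1 q1 pq1; apply/lee_addgt0Pr => e e0; rewrite -EFinD.
have [k Mk] : exists k, M / 2 ^+ k <= e.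
  exists (Num.truncn (M / e)).+1; rewrite ler_pdivrMr ?exprn_gt0//.
  rewrite -ler_pdivrMl// mulrC; apply: ltW (lt_le_trans (truncnS_gt _) _).
  by rewrite -natrX ler_nat ltnW// ltn_expl.
apply: le_trans (circle_mean_iter k _ M0 p1 q1 pq1) _ => //.
by rewrite lee_fin lerD2l.
Qed.

Let circle_deficit1 p q : Normc.normc p <= 1 -> Normc.normc q <= 1 ->
  (Normc.normc p = 1 \/ Normc.normc q = 1) ->
  (\int[haar_circle]_u log_deficit 1 (Normc.normc (u * p + q)%R) <= (ln 2)%:E)%E.
Proof.
move=> p1 q1 pq1.
have nq : Normc.normc (- q) = Normc.normc q := normcN q.
rewrite (_ : (\int[_]_u _)%E = (\int[haar_circle]_u limn (fun n =>
    (truncated_deficit n%:R (Normc.normc (p * u ^+ 1 - - q)%R))%:E))%E); last first.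
  apply: eq_integral => u _; rewrite truncated_deficit_lim.
  by rewrite expr1 mulrC opprK.
rewrite monotone_convergence//; last 3 first.
- by move=> n; exact: measurable_truncated.
- by move=> n u _; rewrite lee_fin truncated_deficit_ge0.
- by move=> u _ m n mn; rewrite lee_fin truncated_deficit_homo// ler_nat.
apply: lime_le.
  apply: ereal_nondecreasing_is_cvgn => m n mn; apply: ge0_le_integral => //.
  - by move=> u _; rewrite lee_fin truncated_deficit_ge0.
  - exact: measurable_truncated.
  - exact: measurable_truncated.
  - by move=> u _; rewrite lee_fin truncated_deficit_homo// ler_nat.
apply: nearW => n; apply: circle_mean_le_ln2; rewrite ?nq//.
Qed.

(** Jensen's formula says that ln |u p + q| has mean ln (max |p| |q|) over the
unit circle; the loss of ln 2 here is the one of the iteration above.  By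
homogeneity the maximum may be taken equal to 1, where that iteration bounds
every truncation. *)
Lemma circle_deficit_le r p q : 0 < r ->
  (\int[haar_circle]_u log_deficit r (Normc.normc (u * p + q)%R) <=
   (ln 2)%:E + log_deficit r (Num.max (Normc.normc p) (Normc.normc q)))%E.
Proof.
move=> r0; set s := Num.max _ _.
have s_ge0 : 0 <= s by rewrite le_max normc_ge0.
have [s0|s0] := leP s 0; first by rewrite (log_deficit_le0 r s0) addey// leey.
have sC0 : s%:C != 0 by rewrite -normc_gt0 normc_real.
pose p' := p / s%:C; pose q' := q / s%:C.
have np' : Normc.normc p' = Normc.normc p / s.
  by rewrite Normc.normcM Normc.normcV normc_real.
have nq' : Normc.normc q' = Normc.normc q / s.
  by rewrite Normc.normcM Normc.normcV normc_real.
have sE u : Normc.normc (u * p + q) = s * Normc.normc (u * p' + q').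
  have -> : u * p + q = s%:C * (u * p' + q').
    by rewrite /p' /q' mulrDr [s%:C * (u * _)]mulrCA !(mulrC s%:C) !divfK.
  by rewrite Normc.normcM normc_real.
have mq : measurable_fun setT (fun u => u * p' + q').
  apply: measurable_complexD; last exact: measurable_cst.
  by apply: measurable_complexM => //; exact: measurable_cst.
have md t : measurable_fun setT (fun u => log_deficit t (Normc.normc (u * p' + q'))).
  apply: (measurableT_comp (measurable_log_deficit t)).
  exact: measurable_normc.
have -> : log_deficit r s = (Num.max 0 (ln r - ln s))%R%:E by exact: log_deficitE.
rewrite -(integral_haar_cst (Num.max 0 _)).
apply: (@le_trans _ _ (\int[haar_circle]_u (log_deficit 1 (Normc.normc (u * p' + q')%R)
    + (Num.max 0 (ln r - ln s))%R%:E))%E).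
  apply: ge0_le_integral => //.
  - by move=> u _; exact: log_deficit_ge0.
  - apply: (eq_measurable_fun (fun u => log_deficit r (s * Normc.normc (u * p' + q')))).
      by move=> u _; rewrite sE.
    apply: (measurableT_comp (measurable_log_deficit r)).
    by apply: measurable_funM => //; exact: measurable_normc.
  - by apply: emeasurable_funD.
  - move=> u _; rewrite sE; apply: le_trans (log_deficit_change r s _) _.
    by rewrite -{1}(mulr1 s) log_deficitM.
rewrite ge0_integralD//; last 2 first.
- by move=> u _; exact: log_deficit_ge0.
- by move=> u _; rewrite lee_fin le_max lexx.
rewrite leeD2r//; apply: circle_deficit1; rewrite ?np' ?nq' ?ler_pdivrMr// ?mul1r.
- by rewrite le_max lexx.
- by rewrite le_max lexx orbT.
- have s1 : s / s = 1 by rewrite divff// gt_eqF.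
  have [e|e] : s = Normc.normc p \/ s = Normc.normc q.
    by rewrite /s /Num.max; case: ifP; [right|left].
  + by left; rewrite -e.
  + by right; rewrite -e.
Qed.

End circle_average.

(** * Independence of two variables and decoupling *)

Section independence.
Context d (T : measurableType d) (R : realType) (P : probability T R).

Definition independent d1 d2 (E1 : measurableType d1) (E2 : measurableType d2)
    (X : T -> E1) (Y : T -> E2) : Prop :=
  forall A B, measurable A -> measurable B ->
    P (X @^-1` A `&` Y @^-1` B) = (P (X @^-1` A) * P (Y @^-1` B))%E.

Lemma independent_sym d1 d2 (E1 : measurableType d1) (E2 : measurableType d2)
    (X : T -> E1) (Y : T -> E2) : independent X Y -> independent Y X.
Proof. by move=> XY A B mA mB; rewrite setIC XY// muleC. Qed.

Lemma independent_cst d1 d2 (E1 : measurableType d1) (E2 : measurableType d2)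
    (X : T -> E1) (c : E2) : independent X (cst c).
Proof.
move=> A B mA mB; rewrite preimage_cst; case: ifPn => _.
  by rewrite setIT probability_setT mule1.
by rewrite setI0 measure0 mule0.
Qed.

Section decoupling.
Context d1 d2 (E1 : measurableType d1) (E2 : measurableType d2).
Variables (X : T -> E1) (Y : T -> E2) (h : E1 * E2 -> \bar R).
Hypotheses (mX : measurable_fun setT X) (mY : measurable_fun setT Y).
Hypotheses (mh : measurable_fun setT h) (h0 : forall z, (0 <= h z)%E).
Hypothesis XY : independent X Y.

(** The law of (X, Y) is the product of the laws of X and Y; Tonelli then
allows Y to be frozen while X is averaged. *)
Lemma ge0_integral_independent :
  (\int[P]_w h (X w, Y w) = \int[P]_w' \int[P]_w h (X w, Y w'))%E.
Proof.
have mXY := measurable_fun_pair mX mY.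
pose pX := isMeasurableFun.Build _ _ _ _ X mX.
pose pY := isMeasurableFun.Build _ _ _ _ Y mY.
pose pXY := isMeasurableFun.Build _ _ _ _ _ mXY.
pose X' : {mfun T >-> E1} := HB.pack X pX.
pose Y' : {mfun T >-> E2} := HB.pack Y pY.
pose Z' : {mfun T >-> (E1 * E2)%type} := HB.pack (fun w => (X w, Y w)) pXY.
rewrite -[LHS]/(\int[P]_w (h \o Z') w)%E -(ge0_integral_distribution Z' mh h0).
transitivity (\int[distribution P X' \x distribution P Y']_z h z)%E.
  apply: eq_measure_integral => A mA _; apply/esym.
  by apply: product_measure_unique => // B C mB mC; exact: XY.
rewrite fubini_tonelli2// ge0_integral_distribution//.
- apply: eq_integral => w _ /=; rewrite /fubini_G ge0_integral_distribution//.
  exact: measurable_fun_pair1.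
- exact: measurable_fun_fubini_tonelli_G.
- by move=> y; exact: integral_ge0.
Qed.

End decoupling.

End independence.

(** * Sums of independent isotropic variables *)

Section isotropic_sums.
Context d (T : measurableType d) (R : realType) (P : probability T R).
Implicit Types (X Y : T -> R[i]).

Definition isotropic X : Prop :=
  forall (u : R[i]) (h : R[i] -> \bar R), Normc.normc u = 1 ->
    measurable_fun setT h -> (forall z, 0 <= h z)%E ->
    (\int[P]_w h (u * X w)%R = \int[P]_w h (X w))%E.

Lemma isotropic_rot X Y (F : R[i] * R[i] -> \bar R) (u : R[i]) :
  measurable_fun setT X -> measurable_fun setT Y ->
  isotropic X -> independent P X Y ->
  measurable_fun setT F -> (forall z, 0 <= F z)%E -> Normc.normc u = 1 ->
  (\int[P]_w F (u * X w, Y w)%R = \int[P]_w F (X w, Y w))%E.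
Proof.
move=> mX mY iX XY mF F0 u1.
rewrite (ge0_integral_independent mX mY mF F0 XY).
have mFu : measurable_fun setT (fun z : R[i] * R[i] => F (u * z.1, z.2)).
  apply: (measurableT_comp mF); apply: measurable_fun_pair => //.
  apply: measurable_complexM; first exact: measurable_cst.
  exact: measurable_fst.
rewrite (ge0_integral_independent mX mY mFu (fun z => F0 _) XY)/=.
apply: eq_integral => w _.
apply: (iX u (fun x => F (x, Y w))) => //.
exact: measurable_fun_pair1.
Qed.

Let measurable_sum : measurable_fun setT (fun z : R[i] * R[i] => z.1 + z.2).
Proof.
by apply: measurable_complexD; [exact: measurable_fst|exact: measurable_snd].
Qed.

Lemma isotropic_sum_rot X Y (g : R[i] -> \bar R) (u : R[i]) :
  measurable_fun setT X -> measurable_fun setT Y ->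
  isotropic X -> independent P X Y ->
  measurable_fun setT g -> (forall z, 0 <= g z)%E -> Normc.normc u = 1 ->
  (\int[P]_w g (u * X w + Y w)%R = \int[P]_w g (X w + Y w)%R)%E.
Proof.
move=> mX mY iX XY mg g0 u1.
apply: (isotropic_rot (F := fun z => g (z.1 + z.2)) mX mY) => //.
exact: (measurableT_comp mg).
Qed.

Lemma isotropicD X Y :
  measurable_fun setT X -> measurable_fun setT Y ->
  isotropic X -> isotropic Y -> independent P X Y ->
  isotropic (fun w => X w + Y w).
Proof.
move=> mX mY iX iY XY u h u1 mh h0.
have muY : measurable_fun setT (fun w => u * Y w).
  by apply: measurable_complexM => //; exact: measurable_cst.
under eq_integral do rewrite mulrDr.
have mG (v : R[i]) : measurable_fun setT (fun z : R[i] * R[i] => h (z.1 + v * z.2)).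
  apply: (measurableT_comp mh); apply: measurable_complexD; first exact: measurable_fst.
  by apply: measurable_complexM; [exact: measurable_cst|exact: measurable_snd].
rewrite (isotropic_rot (F := fun z => h (z.1 + u * z.2)) mX mY)//=.
under eq_integral do rewrite addrC.
rewrite (isotropic_sum_rot mY mX)//; last exact: independent_sym.
by under eq_integral do rewrite addrC.
Qed.

(** Rotating X by u leaves the expectation unchanged, so it can be averaged
over u; after exchanging the integrals, circle_deficit_le applies pointwise.
This replaces a sum by a maximum, which is small only if both terms are. *)
Lemma isotropic_log_deficitD X Y (r : R) : 0 < r ->
  measurable_fun setT X -> measurable_fun setT Y ->
  isotropic X -> independent P X Y ->
  (\int[P]_w log_deficit r (Normc.normc (X w + Y w)%R) <= (ln 2)%:E +
   \int[P]_w log_deficit r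
     (Num.max (Normc.normc (X w)) (Normc.normc (Y w))))%E.
Proof.
move=> r0 mX mY iX XY.
have mf : measurable_fun setT (fun z => log_deficit r (Normc.normc z)).
  apply: (measurableT_comp (measurable_log_deficit r)).
  exact: measurable_normc.
pose G (z : R[i] * T) := log_deficit r (Normc.normc (z.1 * X z.2 + Y z.2)).
have mG : measurable_fun setT G.
  apply: (measurableT_comp mf); apply: measurable_complexD; last first.
    exact: (measurableT_comp mY measurable_snd).
  apply: measurable_complexM; first exact: measurable_fst.
  exact: (measurableT_comp mX measurable_snd).
have G0 z : (0 <= G z)%E by exact: log_deficit_ge0.
apply: (@le_trans _ _ (\int[haar_circle]_u \int[P]_w G (u, w))%E).
  set c := (leLHS).
  rewrite (_ : c = \int[@haar_circle R]_u c)%E; last first.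
    by rewrite integral_cst//= probability_setT mule1.
  apply: ge0_le_integral_haar => //.
  - by move=> _; apply: integral_ge0 => w _; exact: log_deficit_ge0.
  - exact: measurable_fun_fubini_tonelli_F.
  - by move=> u; apply: integral_ge0 => w _; exact: G0.
  - move=> u u1; rewrite /G /=.
    rewrite (isotropic_sum_rot (g := fun z => log_deficit r (Normc.normc z)) mX mY)//.
    by move=> z; exact: log_deficit_ge0.
have -> : (\int[haar_circle]_u \int[P]_w G (u, w) =
    \int[P]_w \int[haar_circle]_u G (u, w))%E.
  exact: (@fubini_tonelli _ _ _ _ _ haar_circle P G mG G0).
have mmax : measurable_fun setT (fun w =>
    log_deficit r (Num.max (Normc.normc (X w)) (Normc.normc (Y w)))).
  apply: (measurableT_comp (measurable_log_deficit r)).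
  by apply: measurable_maxr; exact: measurable_normc.
have -> : ((ln 2)%:E = \int[P]_w (ln 2)%:E)%E.
  by rewrite integral_cst//= probability_setT mule1.
have l2 : (0 <= (ln 2 : R)%:E)%E by rewrite lee_fin ln_ge0// ler1n.
rewrite -ge0_integralD//; last by move=> w _; exact: log_deficit_ge0.
apply: ge0_le_integral => //.
- by move=> w _; apply: integral_ge0 => u _; exact: G0.
- exact: measurable_fun_fubini_tonelli_G.
- exact: emeasurable_funD.
- by move=> w _; rewrite /G; exact: (circle_deficit_le (X w) (Y w) r0).
Qed.

Definition absolute_moment n X : \bar R :=
  (\int[P]_w (Normc.normc (X w) ^+ n)%:E)%E.

Let measurable_normX d' (E : measurableType d') n (f : E -> R[i]) :
  measurable_fun setT f ->
  measurable_fun setT (fun w => Normc.normc (f w) ^+ n).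
Proof. by move=> mf; apply: measurable_funX; exact: measurable_normc. Qed.

Let measurable_moment d' (E : measurableType d') n (f : E -> R[i]) :
  measurable_fun setT f ->
  measurable_fun setT (fun w => (Normc.normc (f w) ^+ n)%:E).
Proof. by move=> mf; apply/measurable_EFinP; exact: measurable_normX. Qed.

(** If averaging g (u x) y over finitely many unit numbers u produces G x y,
then g and G have the same expectation at (X, Y).  With square or fourth roots
of unity this kills the cross terms of the moments of X + Y. *)
Lemma isotropic_mean X Y (us : seq R[i]) (g G : R[i] -> R[i] -> R) :
  measurable_fun setT X -> measurable_fun setT Y ->
  isotropic X -> independent P X Y -> (0 < size us)%N ->
  {in us, forall u, Normc.normc u = 1} ->
  measurable_fun setT (fun z => (g z.1 z.2)%:E) ->
  (forall x y, 0 <= g x y) -> (forall x y, 0 <= G x y) ->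
  measurable_fun setT (fun w => (G (X w) (Y w))%:E) ->
  (forall x y, \sum_(u <- us) g (u * x) y = (size us)%:R * G x y) ->
  (\int[P]_w (g (X w) (Y w))%:E = \int[P]_w (G (X w) (Y w))%:E)%E.
Proof.
move=> mX mY iX XY us0 us1 mg g0 G0 mG gG.
have mgu u : measurable_fun setT (fun w => (g (u * X w) (Y w))%:E).
  have muX : measurable_fun setT (fun w => u * X w).
    by apply: measurable_complexM => //; exact: measurable_cst.
  exact: (measurableT_comp mg (measurable_fun_pair muX mY)).
have n0 : (size us)%:R != 0 :> R by rewrite pnatr_eq0 -lt0n.
have H : ((size us)%:R%:E * \int[P]_w (g (X w) (Y w))%:E =
    (size us)%:R%:E * \int[P]_w (G (X w) (Y w))%:E)%E.
  rewrite -[RHS]ge0_integralZl//; last by move=> w _; rewrite lee_fin.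
  under [RHS]eq_integral do rewrite -EFinM -gG -sumEFin.
  rewrite ge0_integral_sum//; last by move=> u w _; rewrite lee_fin.
  rewrite (eq_big_seq (fun _ => (\int[P]_w (g (X w) (Y w))%:E)%E)); last first.
    move=> u /us1 u1.
    have F0 (z : R[i] * R[i]) : (0 <= (g z.1 z.2)%:E)%E by rewrite lee_fin.
    exact: (isotropic_rot mX mY iX XY mg F0 u1).
  by rewrite big_const_seq count_predT iter_addr_0 mule_natl.
move/(congr1 (mule ((size us)%:R)^-1%:E)): H.
by rewrite !muleA -!EFinM mulVf// !mul1e.
Qed.

Let measurable_momentD n :
  measurable_fun setT (fun z : R[i] * R[i] => (Normc.normc (z.1 + z.2) ^+ n)%:E).
Proof. exact: measurable_moment. Qed.

Lemma absolute_moment2D X Y :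
  measurable_fun setT X -> measurable_fun setT Y ->
  isotropic X -> independent P X Y ->
  absolute_moment 2 (fun w => X w + Y w) =
  (absolute_moment 2 X + absolute_moment 2 Y)%E.
Proof.
move=> mX mY iX XY; rewrite /absolute_moment -ge0_integralD//; first last.
- exact: measurable_moment.
- by move=> w _; rewrite lee_fin sqr_ge0.
- exact: measurable_moment.
- by move=> w _; rewrite lee_fin sqr_ge0.
apply: (isotropic_mean (us := [:: 1; -1]) (g := fun x y => Normc.normc (x + y) ^+ 2)
  (G := fun x y => Normc.normc x ^+ 2 + Normc.normc y ^+ 2) mX mY) => //.
- move=> u; rewrite !inE => /orP[] /eqP->; first exact: Normc.normc1.
  by rewrite (normcN (1 : R[i])) Normc.normc1.
- by move=> x y; rewrite sqr_ge0.
- by move=> x y; rewrite addr_ge0 ?sqr_ge0.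
- by apply/measurable_EFinP; apply: measurable_funD; exact: measurable_normX.
- move=> [x1 x2] [y1 y2]; rewrite big_cons big_seq1 mul1r mulN1r.
  rewrite !sqr_normcE/=; ring.
Qed.

Lemma absolute_moment4D X Y :
  measurable_fun setT X -> measurable_fun setT Y ->
  isotropic X -> independent P X Y ->
  absolute_moment 4 (fun w => X w + Y w) =
  (absolute_moment 4 X + absolute_moment 4 Y +
   4%:E * (absolute_moment 2 X * absolute_moment 2 Y))%E.
Proof.
move=> mX mY iX XY.
have sq4 (z : R[i]) : Normc.normc z ^+ 4 = (Normc.normc z ^+ 2) ^+ 2.
  by rewrite -exprM.
have g0 n (z : R[i]) : (0 <= (Normc.normc z ^+ n)%:E)%E.
  by rewrite lee_fin exprn_ge0// normc_ge0.
have -> : (absolute_moment 2 X * absolute_moment 2 Y = \int[P]_w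
    (Normc.normc (X w) ^+ 2 * Normc.normc (Y w) ^+ 2)%:E)%E.
  have mF : measurable_fun setT (fun z : R[i] * R[i] =>
      (Normc.normc z.1 ^+ 2 * Normc.normc z.2 ^+ 2)%:E).
    apply/measurable_EFinP; apply: measurable_funM.
      exact: (measurable_normX 2 measurable_fst).
    exact: (measurable_normX 2 measurable_snd).
  rewrite (ge0_integral_independent mX mY mF _ XY); last first.
    by move=> z; rewrite lee_fin mulr_ge0 ?sqr_ge0.
  rewrite /absolute_moment -ge0_integralZl//; last 2 first.
  - exact: measurable_moment.
  - by apply: integral_ge0 => w _; exact: g0.
  apply: eq_integral => w _ /=; under [RHS]eq_integral do rewrite EFinM.
  by rewrite ge0_integralZr//; exact: measurable_moment.
have mXY : measurable_fun setT (fun w =>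
    (Normc.normc (X w) ^+ 2 * Normc.normc (Y w) ^+ 2)%:E).
  by apply/measurable_EFinP; apply: measurable_funM; exact: measurable_normX.
rewrite /absolute_moment -ge0_integralZl//; last first.
  by move=> w _; rewrite lee_fin mulr_ge0 ?sqr_ge0.
rewrite -!ge0_integralD//; try by [exact: measurable_moment|exact: measurable_funeM].
- apply: (isotropic_mean (us := [:: 1; -1; Complex 0 1; Complex 0 (-1)])
    (g := fun x y => Normc.normc (x + y) ^+ 4)
    (G := fun x y => Normc.normc x ^+ 4 + Normc.normc y ^+ 4 +
       4 * (Normc.normc x ^+ 2 * Normc.normc y ^+ 2)) mX mY) => //.
  + move=> u; rewrite !inE => /or4P[] /eqP->; first exact: Normc.normc1.
    * by rewrite (normcN (1 : R[i])) Normc.normc1.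
    * by rewrite /= expr0n add0r expr1n sqrtr1.
    * by rewrite /= expr0n add0r sqrrN expr1n sqrtr1.
  + by move=> x y; rewrite exprn_ge0// normc_ge0.
  + by move=> x y; rewrite !addr_ge0 ?mulr_ge0 ?exprn_ge0 ?normc_ge0.
  + apply/measurable_EFinP; apply: measurable_funD; last first.
      by apply: measurable_funM => //; exact/measurable_EFinP.
    by apply: measurable_funD; exact: measurable_normX.
  + move=> [x1 x2] [y1 y2]; rewrite !big_cons big_nil.
    rewrite !sq4 !sqr_normcE/=; ring.
- by move=> w _; rewrite adde_ge0.
- by apply: emeasurable_funD; exact: measurable_moment.
- by move=> w _; rewrite mule_ge0// lee_fin mulr_ge0// sqr_ge0.
Qed.

End isotropic_sums.

(** * The contraction estimate *)

Section contraction.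
Context d (T : measurableType d) (R : realType) (P : probability T R).
Implicit Types (X Y : T -> R[i]) (s t : R).

(** The factor 2 is the one of a complex Gaussian, for which
E |X|^4 = 2 (E |X|^2)^2; the bound is stable under independent sums. *)
Definition moment_controlled X s : Prop :=
  [/\ measurable_fun setT X, isotropic P X, absolute_moment P 2 X = s%:E
    & (absolute_moment P 4 X <= (2 * s ^+ 2)%:E)%E].

Lemma moment_controlledD X Y s t :
  moment_controlled X s -> moment_controlled Y t -> independent P X Y ->
  moment_controlled (fun w => X w + Y w) (s + t).
Proof.
move=> [mX iX X2 X4] [mY iY Y2 Y4] XY; split.
- exact: measurable_complexD.
- exact: isotropicD.
- by rewrite absolute_moment2D// X2 Y2.
- rewrite absolute_moment4D// X2 Y2 -!EFinM.
  apply: (@le_trans _ _ ((2 * s ^+ 2)%:E + (2 * t ^+ 2)%:E + (4 * (s * t))%:E)%E).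
    by rewrite leeD2r// leeD.
  rewrite -!EFinD lee_fin; lra.
Qed.

(** A quadratic polynomial in |z|^2 / t which dominates the indicator of
|z|^2 <= t / 2.  With mean 1 and second moment at most 2 for |z|^2 / t, a
weight c (|z|^2 / t - 3)^2 has mean at most 5 c, and c = 4 / 25 is the least
value for which it reaches 1 at |z|^2 / t = 1 / 2. *)
Definition small_ball_weight t (z : R[i]) : R :=
  4 / 25 * (Normc.normc z ^+ 2 / t - 3) ^+ 2.

Lemma small_ball_weight_ge0 t z : 0 <= small_ball_weight t z.
Proof. by rewrite mulr_ge0// sqr_ge0. Qed.

Lemma small_ball_weight_ge1 t z : 0 < t -> 2 * Normc.normc z ^+ 2 <= t ->
  1 <= small_ball_weight t z.
Proof.
move=> t0 zt; rewrite /small_ball_weight.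
have : Normc.normc z ^+ 2 / t <= 1 / 2 by rewrite ler_pdivrMr//; lra.
nra.
Qed.

Lemma measurable_small_ball_weight t d' (E : measurableType d')
    (f : E -> R[i]) : measurable_fun setT f ->
  measurable_fun setT (fun w => small_ball_weight t (f w)).
Proof.
move=> mf; apply: measurable_funM => //; apply: measurable_funX.
apply: measurable_funB => //; apply: measurable_funM => //.
by apply: measurable_funX; exact: measurable_normc.
Qed.

(** A Paley-Zygmund estimate.  The negative term of the square is moved to
the left-hand side so that only nonnegative functions are integrated. *)
Lemma integral_small_ball_weight Y t : 0 < t -> moment_controlled Y t ->
  (\int[P]_w (small_ball_weight t (Y w))%:E <= (4 / 5)%:E)%E.
Proof.
move=> t0 [mY iY Y2 Y4].
have mom_ge0 n w : (0 <= (Normc.normc (Y w) ^+ n)%:E)%E.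
  by rewrite lee_fin exprn_ge0// normc_ge0.
have mmom n : measurable_fun setT (fun w => (Normc.normc (Y w) ^+ n)%:E).
  by apply/measurable_EFinP; apply: measurable_funX; exact: measurable_normc.
have c1 : 0 <= 24 / (25 * t) by rewrite divr_ge0// mulr_ge0// ltW.
have c2 : 0 <= 4 / (25 * t ^+ 2) by rewrite divr_ge0// mulr_ge0// sqr_ge0.
have E : (\int[P]_w (small_ball_weight t (Y w))%:E +
    (24 / (25 * t))%:E * absolute_moment P 2 Y =
    (4 / (25 * t ^+ 2))%:E * absolute_moment P 4 Y + (36 / 25)%:E)%E.
  rewrite /absolute_moment -!ge0_integralZl//; try by move=> w _; exact: mom_ge0.
  rewrite (_ : (36 / 25)%:E = \int[P]_w (36 / 25)%:E)%E; last first.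
    by rewrite integral_cst//= probability_setT mule1.
  have mweight : measurable_fun setT (fun w => (small_ball_weight t (Y w))%:E).
    by apply/measurable_EFinP; exact: measurable_small_ball_weight.
  have weight0 w : (0 <= (small_ball_weight t (Y w))%:E)%E.
    by rewrite lee_fin small_ball_weight_ge0.
  rewrite -!ge0_integralD//;
    try by [exact: measurable_funeM | move=> w _; rewrite ?mule_ge0// lee_fin].
  apply: eq_integral => w _; rewrite -!EFinM -!EFinD /small_ball_weight.
  congr EFin; field; exact: lt0r_neq0.
have : (\int[P]_w (small_ball_weight t (Y w))%:E + (24 / 25)%:E <=
   (8 / 25)%:E + (36 / 25)%:E)%E.
  have -> : 24 / 25 = 24 / (25 * t) * t by field; exact: lt0r_neq0.
  rewrite EFinM -Y2 E leeD2r//.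
  apply: le_trans (lee_wpmul2l _ Y4) _; first by rewrite lee_fin.
  rewrite -EFinM lee_fin le_eqVlt; apply/orP; left; apply/eqP.
  by field; exact: lt0r_neq0.
rewrite -EFinD -leeBrDr// -EFinB => /le_trans; apply.
rewrite lee_fin; lra.
Qed.

(** Either y is not small, and the deficit of the maximum is bounded by a
constant, or y is small, the weight is at least 1, and the deficit of x
bounds that of the maximum up to the same constant. *)
Lemma log_deficit_max_le rho r s t (x y : R[i]) : 1 <= rho ->
  0 < r -> 0 < s -> 0 < t -> r ^+ 2 <= rho * s ^+ 2 -> r ^+ 2 <= rho * t ^+ 2 ->
  (log_deficit r (Num.max (Normc.normc x) (Normc.normc y)) <=
   (ln (2 * rho))%:E + (small_ball_weight (t ^+ 2) y)%:E *
     (log_deficit s (Normc.normc x) + (ln (2 * rho))%:E))%E.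
Proof.
move=> rho1 r0 s0 t0 rs rt.
have rho0 : 0 < rho by lra.
have L0 : 0 <= ln (2 * rho) by rewrite ln_ge0//; lra.
have h0 : (0 <= log_deficit s (Normc.normc x) + (ln (2 * rho))%:E)%E.
  by rewrite adde_ge0 ?log_deficit_ge0// lee_fin.
have lnle a : 0 < a -> r ^+ 2 <= 2 * rho * a ^+ 2 -> ln r - ln a <= ln (2 * rho).
  move=> a0 ra; rewrite lerBlDr -lnM ?posrE ?mulr_gt0//.
  have m0 : 0 <= 2 * rho * a by apply: ltW; rewrite !mulr_gt0.
  rewrite ler_ln ?posrE ?mulr_gt0// -(@ler_pXn2r _ 2) ?nnegrE ?(ltW r0)//.
  apply: le_trans ra _; rewrite exprMn ler_wpM2r ?sqr_ge0// expr2.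
  by rewrite ler_peMl//; lra.
have [yt|ty] := leP (t ^+ 2) (2 * Normc.normc y ^+ 2).
- have y0 : 0 < Normc.normc y.
    rewrite lt_def normc_ge0 andbT; apply/eqP => y0; move: yt.
    by rewrite y0 expr0n mulr0 leNgt exprn_gt0.
  apply: (@le_trans _ _ (log_deficit r (Normc.normc y))).
    by apply: le_log_deficit; rewrite le_max lexx orbT.
  apply: (@le_trans _ _ (ln (2 * rho))%:E); last first.
    by rewrite leeDl// mule_ge0// lee_fin small_ball_weight_ge0.
  rewrite log_deficitE// lee_fin ge_max L0/= lnle//.
  by apply: le_trans rt _; have := ler_wpM2l (ltW rho0) yt; lra.
- apply: (@le_trans _ _ (log_deficit r (Normc.normc x))).
    by apply: le_log_deficit; rewrite le_max lexx.
  apply: (@le_trans _ _ (log_deficit s (Normc.normc x) + (ln (2 * rho))%:E)%E).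
    apply: le_trans (log_deficit_change r s _) _; rewrite leeD2l// lee_fin.
    rewrite ge_max L0/= lnle//; apply: le_trans rs _.
    by rewrite ler_wpM2r ?sqr_ge0//; lra.
  apply: (@le_trans _ _ ((small_ball_weight (t ^+ 2) y)%:E *
     (log_deficit s (Normc.normc x) + (ln (2 * rho))%:E))%E); last first.
    by rewrite leeDr// lee_fin.
  rewrite lee_pemull// lee_fin small_ball_weight_ge1// ?exprn_gt0//.
  exact: ltW.
Qed.

(** The contraction: in passing from X to X + Y the deficit bound D is
multiplied by 4 / 5 < 1, at the price of an additive constant that depends
only on how comparable the variances are. *)
Lemma expected_log_deficitD rho s t D X Y : 1 <= rho -> 0 < s -> 0 < t ->
  s ^+ 2 + t ^+ 2 <= rho * s ^+ 2 -> s ^+ 2 + t ^+ 2 <= rho * t ^+ 2 ->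
  moment_controlled X (s ^+ 2) -> moment_controlled Y (t ^+ 2) ->
  independent P X Y ->
  (\int[P]_w log_deficit s (Normc.normc (X w)) <= D%:E)%E ->
  (\int[P]_w log_deficit (Num.sqrt (s ^+ 2 + t ^+ 2)) (Normc.normc (X w + Y w)%R)
    <= (ln 2 + ln (2 * rho) + 4 / 5 * (D + ln (2 * rho)))%:E)%E.
Proof.
move=> rho1 s0 t0 hs ht cX cY XY XD.
have [mX iX _ _] := cX; have [mY _ _ _] := cY.
have r0 : 0 < Num.sqrt (s ^+ 2 + t ^+ 2).
  by rewrite sqrtr_gt0 addr_gt0// exprn_gt0.
have L0 : 0 <= ln (2 * rho) by rewrite ln_ge0//; lra.
apply: le_trans (isotropic_log_deficitD r0 mX mY iX XY) _.
rewrite -addrA EFinD leeD2l// EFinD.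
have mlog q d' (E : measurableType d') (Z : E -> R[i]) : measurable_fun setT Z ->
    measurable_fun setT (fun w => log_deficit q (Normc.normc (Z w))).
  move=> mZ; apply: (measurableT_comp (measurable_log_deficit q)).
  exact: measurable_normc.
pose F (z : R[i] * R[i]) : \bar R := ((small_ball_weight (t ^+ 2) z.2)%:E *
     (log_deficit s (Normc.normc z.1) + (ln (2 * rho))%:E))%E.
have F0 z : (0 <= F z)%E.
  rewrite mule_ge0 ?adde_ge0 ?lee_fin ?small_ball_weight_ge0//.
  exact: log_deficit_ge0.
have mF : measurable_fun setT F.
  apply: emeasurable_funM.
    by apply/measurable_EFinP; exact: (measurable_small_ball_weight _ measurable_snd).
  apply: emeasurable_funD => //.
  exact: (mlog _ _ _ _ measurable_fst).
have mFXY : measurable_fun setT (fun w => F (X w, Y w)).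
  exact: (measurableT_comp mF (measurable_fun_pair mX mY)).
apply: (@le_trans _ _ (\int[P]_w ((ln (2 * rho))%:E + F (X w, Y w)))%E).
  apply: ge0_le_integral => //.
  - by move=> w _; exact: log_deficit_ge0.
  - apply: (measurableT_comp (measurable_log_deficit _)).
    by apply: measurable_maxr; exact: measurable_normc.
  - exact: emeasurable_funD.
  - by move=> w _; apply: log_deficit_max_le => //;
      rewrite sqr_sqrtr// addr_ge0// sqr_ge0.
rewrite ge0_integralD//.
rewrite integral_cst//= probability_setT mule1 leeD2l//.
rewrite (ge0_integral_independent mX mY mF F0 XY) /F/=.
have IX0 : (0 <= \int[P]_w (log_deficit s (Normc.normc (X w)) + (ln (2 * rho))%:E))%E.
  by apply: integral_ge0 => w _; rewrite adde_ge0 ?lee_fin// log_deficit_ge0.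
under eq_integral => w' _.
  rewrite ge0_integralZl//; last 3 first.
  - by apply: emeasurable_funD => //; exact: mlog.
  - by move=> w _; rewrite adde_ge0 ?lee_fin// log_deficit_ge0.
  - by rewrite lee_fin small_ball_weight_ge0.
  over.
rewrite ge0_integralZr//; last 2 first.
- by apply/measurable_EFinP; exact: measurable_small_ball_weight.
- by move=> w _; rewrite lee_fin small_ball_weight_ge0.
rewrite EFinM; apply: lee_pmul => //.
- by apply: integral_ge0 => w _; rewrite lee_fin small_ball_weight_ge0.
- by apply: integral_small_ball_weight => //; rewrite exprn_gt0.
- rewrite ge0_integralD//; last 2 first.
  + by move=> w _; exact: log_deficit_ge0.
  + exact: mlog.
  by rewrite integral_cst//= probability_setT mule1 EFinD leeD2r.
Qed.

End contraction.

(** * Independence of sums over disjoint index sets *)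

Section independent_sums.
Context d (T : measurableType d) (R : realType) (P : probability T R).

(** Both sides are finite measures in A, which agree on a pi-system. *)
Lemma probabilityI_generated (G : set (set T)) (F : set T) :
  G `<=` measurable -> G setT -> setI_closed G -> measurable F ->
  (forall A, G A -> P (A `&` F) = (P A * P F)%E) ->
  forall A, <<s G >> A -> P (A `&` F) = (P A * P F)%E.
Proof.
move=> Gm GT GI mF GF A sGA.
pose c := NngNum (fine_ge0 (measure_ge0 P F)).
have cE : (c%:num)%:E = P F by rewrite /= fineK// fin_num_measure.
rewrite -[LHS]/(mrestr P mF A) muleC -cE -[RHS]/(mscale c P A).
apply: (g_sigma_algebra_measure_unique G Gm (fun=> setT)) => //.
- by rewrite bigcup_const//; exists 0%N.
- by move=> B GB; rewrite /= /mrestr /mscale/= -/c cE GF// muleC.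
- by move=> _; rewrite /= /mrestr setTI ltey_eq fin_num_measure.
Qed.

Section cylinders.
Context d' (E : measurableType d') (I : finType) (Z : I -> {RV P >-> E}).

(** The pi-system that generates the sigma-algebra of the variables with
index in J. *)
Definition cylinder (J : {set I}) : set (set T) := [set C |
  exists2 A : I -> set E, (forall j, measurable (A j)) &
  C = \bigcap_(j in [set` J]) (Z j @^-1` A j)].

Let measurable_preimage j A : measurable A -> measurable (Z j @^-1` A).
Proof. by move=> mA; rewrite -[X in measurable X]setTI; exact: measurable_funP. Qed.

Lemma cylinder_measurable J : cylinder J `<=` measurable.
Proof.
move=> _ [A mA ->]; apply: fin_bigcap_measurable; first exact: finite_finset.
by move=> j _; exact: measurable_preimage.
Qed.

Lemma cylinderT J : cylinder J setT.
Proof.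
exists (fun=> setT) => //; apply/esym; rewrite -subTset => w _ j _.
by [].
Qed.

Lemma cylinder_setI J : setI_closed (cylinder J).
Proof.
move=> _ _ [A mA ->] [B mB ->]; exists (fun j => A j `&` B j).
  by move=> j; exact: measurableI.
by rewrite -bigcapI.
Qed.

Lemma cylinder_preimage (J : {set I}) j (A : set E) : j \in J -> measurable A ->
  cylinder J (Z j @^-1` A).
Proof.
move=> jJ mA; exists (fun i => if i == j then A else setT).
  by move=> i; case: ifP.
apply/seteqP; split => [w Aw i _ /=|w /(_ j)/=]; first by case: eqP => // ->.
by rewrite eqxx; exact.
Qed.

Hypothesis indepZ : mutually_independent Z.

(** One family of events over J and J' together, to which mutual
independence applies; the product then splits. *)
Lemma cylinder_independent (J J' : {set I}) C C' : [disjoint J & J']%B ->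
  cylinder J C -> cylinder J' C' -> P (C `&` C') = (P C * P C')%E.
Proof.
move=> JJ' [A mA ->] [B mB ->].
pose D j := if j \in J then A j else B j.
have mD j : measurable (D j) by rewrite /D; case: ifP.
have DJ j : j \in J -> D j = A j by rewrite /D => ->.
have DJ' j : j \in J' -> D j = B j.
  by rewrite /D => jJ'; rewrite (disjointFl JJ' jJ').
have -> : \bigcap_(j in [set` J]) (Z j @^-1` A j) `&`
    \bigcap_(j in [set` J']) (Z j @^-1` B j) =
    \bigcap_(j in [set` J :|: J']) (Z j @^-1` D j).
  apply/seteqP; split => [w [Aw Bw] j /=|w Dw].
    by rewrite inE => /orP[jJ|jJ']; [rewrite DJ//; exact: Aw|rewrite DJ'//; exact: Bw].
  split=> j /= jJ.
    by rewrite -DJ//; apply: Dw; rewrite /= inE jJ.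
  by rewrite -DJ'//; apply: Dw; rewrite /= inE jJ orbT.
rewrite !indepZ// (big_setID J) /=.
rewrite finset.setUK finset.setDUl finset.setDv finset.set0U.
have /finset.setDidPl -> : [disjoint J' & J]%B by rewrite disjoint_sym.
by congr (_ * _)%E; apply: eq_bigr => j jJ; [rewrite DJ|rewrite DJ'].
Qed.

(** Two applications of the pi-lambda theorem, one for each side. *)
Lemma independent_cylinder_measurable d1 d2 (E1 : measurableType d1)
    (E2 : measurableType d2) (J J' : {set I}) (X : T -> E1) (Y : T -> E2) :
  [disjoint J & J']%B ->
  (forall A, measurable A -> <<s cylinder J >> (X @^-1` A)) ->
  (forall A, measurable A -> <<s cylinder J' >> (Y @^-1` A)) ->
  independent P X Y.
Proof.
move=> JJ' sX sY A B mA mB.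
have sm K : <<s cylinder K >> `<=` measurable.
  by apply: smallest_sub; [exact: sigma_algebra_measurable|exact: cylinder_measurable].
have mYB : measurable (Y @^-1` B) by apply: sm; exact: sY mB.
apply: (probabilityI_generated (@cylinder_measurable J) (@cylinderT J)
  (@cylinder_setI J) mYB) (sX _ mA) => C cC.
rewrite setIC muleC.
apply: (probabilityI_generated (@cylinder_measurable J') (@cylinderT J')
  (@cylinder_setI J') (cylinder_measurable cC)) (sY _ mB) => C' cC'.
by rewrite setIC muleC; exact: cylinder_independent cC cC'.
Qed.

End cylinders.

Section weighted_sums.
Context (I : finType) (Z : I -> {RV P >-> R[i]}) (b : I -> R).

Definition partial_sum (J : {set I}) (w : T) : R[i] :=
  \sum_(j in J) (b j)%:C * Z j w.

Lemma measurable_complex_sum d' (E : measurableType d') (s : seq I)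
    (p : pred I) (f : I -> E -> R[i]) :
  (forall j, p j -> measurable_fun setT (f j)) ->
  measurable_fun setT (fun w => \sum_(j <- s | p j) f j w).
Proof.
move=> mf; elim: s => [|j s ih].
  by under eq_fun do rewrite big_nil; exact: measurable_cst.
under eq_fun do rewrite big_cons.
by case pj: (p j) => //; apply: measurable_complexD => //; exact: mf.
Qed.

Lemma partial_sum_generated J A : measurable A ->
  <<s cylinder Z J >> (partial_sum J @^-1` A).
Proof.
move=> mA; pose TJ := g_sigma_algebraType (cylinder Z J).
have : measurable_fun [set: TJ] (partial_sum J : TJ -> R[i]).
  apply: measurable_complex_sum => j jJ.
  apply: measurable_complexM; first exact: measurable_cst.
  move=> _ B mB; rewrite setTI; apply: sub_sigma_algebra.
  exact: cylinder_preimage.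
by move=> /(_ measurableT _ mA); rewrite setTI.
Qed.

Lemma independent_partial_sum (J J' : {set I}) : mutually_independent Z ->
  [disjoint J & J']%B -> independent P (partial_sum J) (partial_sum J').
Proof.
by move=> iZ JJ'; apply: (independent_cylinder_measurable iZ JJ') => A;
  exact: partial_sum_generated.
Qed.

Lemma partial_sum_setID (J J' : {set I}) w : J' \subset J ->
  partial_sum J w = partial_sum J' w + partial_sum (J :\: J') w.
Proof. by move=> /finset.setIidPr JJ'; rewrite /partial_sum (big_setID J')/= JJ'. Qed.

End weighted_sums.

End independent_sums.

(** * Weighted sums of Steinhaus variables *)

Section steinhaus_sums.
Context d (T : measurableType d) (R : realType) (P : probability T R).

Lemma ge0_integral_steinhaus (Z : {RV P >-> R[i]}) (h : R[i] -> \bar R) :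
  steinhaus Z -> measurable_fun setT h -> (forall z, 0 <= h z)%E ->
  (\int[P]_w h (Z w) = \int[haar_circle]_z h z)%E.
Proof.
move=> sZ mh h0; rewrite -(ge0_integral_distribution Z mh h0).
by apply: eq_measure_integral => A mA _; exact: sZ.
Qed.

Lemma ge0_integral_haar_cst (h : R[i] -> \bar R) (c : R) : 0 <= c ->
  measurable_fun setT h -> (forall z, 0 <= h z)%E ->
  (forall u, Normc.normc u = 1 -> h u = c%:E) ->
  (\int[haar_circle]_z h z = c%:E)%E.
Proof.
move=> c0 mh h0 hc.
have <- : (\int[@haar_circle R]_z c%:E = c%:E)%E.
  by rewrite integral_cst//= probability_setT mule1.
by apply/eqP; rewrite eq_le; apply/andP; split;
  apply: ge0_le_integral_haar => // u /hc ->.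
Qed.

Lemma moment_controlled_steinhaus (Z : {RV P >-> R[i]}) (b : R) :
  steinhaus Z -> 0 < b -> moment_controlled P (fun w => b%:C * Z w) (b ^+ 2).
Proof.
move=> sZ b0.
have mb : measurable_fun setT (fun z : R[i] => b%:C * z).
  by apply: measurable_complexM => //; exact: measurable_cst.
have mom n : absolute_moment P n (fun w => b%:C * Z w) = (b ^+ n)%:E.
  rewrite /absolute_moment.
  rewrite (ge0_integral_steinhaus (h := fun z => (Normc.normc (b%:C * z) ^+ n)%:E) sZ).
  - apply: ge0_integral_haar_cst.
    + by rewrite exprn_ge0// ltW.
    + by apply/measurable_EFinP; apply: measurable_funX; exact: measurable_normc.
    + by move=> z; rewrite lee_fin exprn_ge0// normc_ge0.
    + by move=> u u1; rewrite Normc.normcM u1 mulr1 normc_real// ltW.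
  - by apply/measurable_EFinP; apply: measurable_funX; exact: measurable_normc.
  - by move=> z; rewrite lee_fin exprn_ge0// normc_ge0.
split.
- by apply: (measurableT_comp mb); exact: measurable_funP.
- move=> u h u1 mh h0.
  have mhb : measurable_fun setT (fun z => h (b%:C * z)) by exact: measurableT_comp.
  under eq_integral do rewrite mulrCA.
  rewrite (ge0_integral_steinhaus (h := fun z => h (b%:C * (u * z))) sZ)//.
    rewrite (ge0_integral_haar_rot (F := fun z => h (b%:C * z)) u1)//.
    by rewrite (ge0_integral_steinhaus (h := fun z => h (b%:C * z)) sZ).
  apply: (measurableT_comp mhb).
  by apply: measurable_complexM => //; exact: measurable_cst.
- exact: mom.
- rewrite mom lee_fin -exprM.
  by have := exprn_ge0 4 (ltW b0); lra.
Qed.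

Lemma expected_log_deficit_steinhaus (Z : {RV P >-> R[i]}) (b : R) :
  steinhaus Z -> 0 < b ->
  (\int[P]_w log_deficit b (Normc.normc (b%:C * Z w)%R) = 0)%E.
Proof.
move=> sZ b0.
have mh : measurable_fun setT (fun z : R[i] => log_deficit b (Normc.normc (b%:C * z))).
  apply: (measurableT_comp (measurable_log_deficit b)); apply: measurable_normc.
  by apply: measurable_complexM => //; exact: measurable_cst.
rewrite (ge0_integral_steinhaus (h := fun z => log_deficit b (Normc.normc (b%:C * z))) sZ)//.
  apply: ge0_integral_haar_cst => //.
  - by move=> z; exact: log_deficit_ge0.
  - by move=> u u1; rewrite Normc.normcM u1 mulr1 normc_real ?ltW// log_deficit_eq0.
by move=> z; exact: log_deficit_ge0.
Qed.

Section uniform_bound.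
Context (I : finType) (Z : I -> {RV P >-> R[i]}) (b : I -> R).
Context (K lo : R).
Hypotheses (sZ : forall j, steinhaus (Z j)) (iZ : mutually_independent Z).
Hypotheses (K1 : 1 <= K) (lo0 : 0 < lo).
Hypothesis (blo : forall j, lo <= b j) (bhi : forall j, b j <= K * lo).

Let b0 j : 0 < b j. Proof. exact: lt_le_trans (blo j). Qed.

Definition partial_variance (J : {set I}) : R := \sum_(j in J) b j ^+ 2.

(** The factor 3 is needed for three elements, which split into one
and two. *)
Lemma exists_half_subset (J : {set I}) : (1 < #|J|)%N ->
  exists J' : {set I}, [/\ J' \subset J, (0 < #|J'| < #|J|)%N,
    (#|J| <= 3 * #|J'|)%N & (#|J| <= 3 * #|J :\: J'|)%N].
Proof.
move=> J1; exists [set x in take (#|J|./2) (enum J)].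
set J' := [set x in _].
have sJ : J' \subset J.
  by apply/fintype.subsetP => x; rewrite inE => /mem_take; rewrite mem_enum.
have cJ' : #|J'| = #|J|./2.
  rewrite cardsE; have /card_uniqP -> : uniq (take #|J|./2 (enum J)).
    by rewrite take_uniq// enum_uniq.
  by rewrite size_take -cardE; case: ifP => //; rewrite -divn2; lia.
have cD : #|J :\: J'| = (#|J| - #|J|./2)%N by rewrite cardsD (finset.setIidPr sJ) cJ'.
by rewrite cD cJ' -divn2; split=> //; lia.
Qed.

Lemma partial_variance_ge (J : {set I}) : #|J|%:R * lo ^+ 2 <= partial_variance J.
Proof.
rewrite mulr_natl -sumr_const; apply: ler_sum => j _.
by rewrite ler_sqr ?nnegrE ?blo ?(ltW lo0) ?(ltW (b0 j)).
Qed.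

Lemma partial_variance_le (J : {set I}) :
  partial_variance J <= #|J|%:R * (K * lo) ^+ 2.
Proof.
rewrite mulr_natl -sumr_const; apply: ler_sum => j _.
rewrite ler_sqr ?nnegrE ?bhi ?(ltW (b0 j))// mulr_ge0 ?(ltW lo0)//.
exact: le_trans ler01 K1.
Qed.

Lemma partial_variance_gt0 (J : {set I}) : (0 < #|J|)%N -> 0 < partial_variance J.
Proof.
move=> J0; apply: lt_le_trans (partial_variance_ge J).
by rewrite mulr_gt0 ?ltr0n ?exprn_gt0.
Qed.

Lemma partial_variance_comparable (J J' : {set I}) : (#|J| <= 3 * #|J'|)%N ->
  partial_variance J <= 3 * K ^+ 2 * partial_variance J'.
Proof.
move=> JJ'; apply: le_trans (partial_variance_le J) _.
apply: (@le_trans _ _ (3 * K ^+ 2 * (#|J'|%:R * lo ^+ 2))); last first.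
  by rewrite ler_wpM2l ?partial_variance_ge// mulr_ge0// sqr_ge0.
have : #|J|%:R <= 3 * #|J'|%:R :> R by rewrite -natrM ler_nat.
move=> /(ler_wpM2r (sqr_ge0 (K * lo))); rewrite exprMn; lra.
Qed.

(** A solution D of ln 2 + L + 4 / 5 (D + L) <= D, where
L = ln (2 rho) and rho = 3 K^2 bounds the ratio of the variance of a sum to
the variance of either of its halves. *)
Definition deficit_bound : R := 5 * ln 2 + 9 * ln (2 * (3 * K ^+ 2)).

(** Strong induction on the number of terms, splitting the sum into two
halves: the contraction reproduces the bound D, so it does not deteriorate
with the number of terms.  For one term the modulus is constant and there is
no deficit. *)
Lemma partial_sum_deficit (J : {set I}) : (0 < #|J|)%N ->
  moment_controlled P (partial_sum Z b J) (partial_variance J) /\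
  (\int[P]_w log_deficit (Num.sqrt (partial_variance J))
     (Normc.normc (partial_sum Z b J w)) <= deficit_bound%:E)%E.
Proof.
have K2 : 1 <= K ^+ 2 by rewrite exprn_ege1.
have L0 : 0 <= ln (2 * (3 * K ^+ 2)) by rewrite ln_ge0//; lra.
have l20 : 0 <= ln 2 :> R by rewrite ln_ge0// ler1n.
have [n] := ubnP #|J|; elim: n J => // n ih J Jn J0.
have [J1|J1] := leqP #|J| 1.
  have /cards1P[j ->] : #|J| == 1%N by rewrite eqn_leq J1.
  have E w : partial_sum Z b [set j] w = (b j)%:C * Z j w.
    by rewrite /partial_sum big_set1.
  have -> : partial_sum Z b [set j] = (fun w => (b j)%:C * Z j w) by exact/funext.
  rewrite /partial_variance big_set1; split; first exact: moment_controlled_steinhaus.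
  rewrite sqrtr_sqr (ger0_norm (ltW (b0 j))) expected_log_deficit_steinhaus//.
  by rewrite lee_fin addr_ge0// mulr_ge0.
have [J' [sJ' /andP[J'0 J'J] h1 h2]] := exists_half_subset J1.
have cD : #|J :\: J'| = (#|J| - #|J'|)%N by rewrite cardsD (finset.setIidPr sJ').
have [cX dX] := ih J' (leq_trans J'J Jn) J'0.
have D0 : (0 < #|J :\: J'|)%N by rewrite cD subn_gt0.
have Dn : (#|J :\: J'| < n)%N by rewrite cD; lia.
have [cY _] := ih _ Dn D0.
have iXY : independent P (partial_sum Z b J') (partial_sum Z b (J :\: J')).
  apply: independent_partial_sum => //.
  by rewrite disjoint_sym finset.disjoints_subset finset.setDE finset.subsetIr.
have -> : partial_sum Z b J =
    (fun w => partial_sum Z b J' w + partial_sum Z b (J :\: J') w).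
  by apply/funext => w; rewrite (partial_sum_setID _ _ _ sJ').
have vE : partial_variance J = partial_variance J' + partial_variance (J :\: J').
  by rewrite /partial_variance (big_setID J')/= (finset.setIidPr sJ').
have [v1 v2] := (partial_variance_gt0 J'0, partial_variance_gt0 D0).
split; first by rewrite vE; exact: moment_controlledD.
have s1 := sqr_sqrtr (ltW v1); have s2 := sqr_sqrtr (ltW v2).
rewrite vE -{1}s1 -{1}s2.
apply: le_trans (@expected_log_deficitD _ _ _ P (3 * K ^+ 2) _ _
  deficit_bound _ _ _ _ _ _ _ _ _ iXY dX) _.
- lra.
- by rewrite sqrtr_gt0.
- by rewrite sqrtr_gt0.
- by rewrite s1 s2 -vE partial_variance_comparable.
- by rewrite s1 s2 -vE partial_variance_comparable.
- by rewrite s1.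
- by rewrite s2.
- rewrite lee_fin /deficit_bound; lra.
Qed.

End uniform_bound.

End steinhaus_sums.

(** * From the deficit to the expectation of the logarithm *)

Section expected_log.
Context d (T : measurableType d) (R : realType) (P : probability T R).

Lemma measurable_lne_EFin : measurable_fun setT (fun t : R => lne t%:E).
Proof.
rewrite /lne; apply: measurable_fun_ifT => //; first exact: measurable_fun_ler.
by apply/measurable_EFinP; exact: measurable_ln.
Qed.

(** The integral of the logarithm may be +oo; comparing positive and negative
parts separately requires integrability of the lower bound alone. *)
Lemma expected_lne_ge (r D : R) (X : T -> R[i]) : 0 < r ->
  measurable_fun setT X ->
  (\int[P]_w log_deficit r (Normc.normc (X w)) <= D%:E)%E ->
  ((ln r - D)%:E <= \int[P]_w lne (Normc.normc (X w))%:E)%E.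
Proof.
move=> r0 mX XD; have mnX := measurable_normc mX.
pose f w := log_deficit r (Normc.normc (X w)).
have f0 w : (0 <= f w)%E by exact: log_deficit_ge0.
have mf : measurable_fun setT f by exact: (measurableT_comp (measurable_log_deficit r)).
have mc : measurable_fun setT (fun _ : T => (ln r)%:E) by exact: measurable_cst.
have mg : measurable_fun setT (fun w => lne (Normc.normc (X w))%:E).
  exact: (measurableT_comp measurable_lne_EFin mnX).
have mcf : measurable_fun setT (fun w => (ln r)%:E - f w)%E by exact: emeasurable_funB.
have intf : P.-integrable setT f.
  apply/integrableP; split => //; under eq_integral do rewrite gee0_abs//.
  exact: le_lt_trans XD (ltry _).
have intc : P.-integrable setT (fun=> (ln r)%:E).
  exact: (finite_measure_integrable_cst P (ln r)).
apply: (@le_trans _ _ (\int[P]_w ((ln r)%:E - f w))%E).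
  rewrite integralB// integral_cst//= probability_setT mule1 EFinB.
  by rewrite leeB.
rewrite integralE [leRHS]integralE; apply: leeB; apply: ge0_le_integral => //.
- exact: measurable_funepos.
- exact: measurable_funepos.
- by move=> w /mem_set; apply: funepos_le => w' _; exact: lne_ge_log_deficit.
- exact: measurable_funeneg.
- exact: measurable_funeneg.
- by move=> w /mem_set; apply: funeneg_le => w' _; exact: lne_ge_log_deficit.
Qed.

End expected_log.

Unset Implicit Arguments.
Set Strict Implicit.

Theorem lemma4p1 (R : realType) (K : R) (hK : 1 <= K) :
  exists C : R, forall (m : nat), (5 <= m)%N ->
    forall (d : measure_display) (T : measurableType d) (P : probability T R)
      (Z : 'I_m -> {RV P >-> R[i]}),
    (forall j, steinhaus (Z j)) ->
    mutually_independent Z ->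
    forall b : 'I_m -> R,
    (forall j, 0 < b j) ->
    max_entry b / min_entry b <= K ->
    forall S : R, 0 < S -> S ^+ 2 = \sum_(j < m) b j ^+ 2 ->
    forall a : R[i],
    ((ln S - C)%:E <=
     \int[P]_w lne (Normc.normc (a + \sum_(j < m) (b j)%:C * Z j w))%:E)%E.
Proof.
exists (ln 2 + deficit_bound K) => m m5 d T P Z sZ iZ b b0 bK S S0 SE a.
have m0 : (0 < m)%N by exact: leq_trans m5.
have b_ge0 j : 0 <= b j by exact: ltW.
have [_ bmax] := max_entry_spec m0 b_ge0.
have [[j0 minE] bmin] := min_entry_spec m0 b_ge0.
have lo0 : 0 < min_entry b by rewrite minE.
have bhi j : b j <= K * min_entry b.
  by apply: le_trans (bmax j) _; rewrite -ler_pdivrMr.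
have J0 : (0 < #|[set: 'I_m]%SET|)%N by rewrite cardsT card_ord.
have [cX dX] := partial_sum_deficit sZ iZ hK lo0 bmin bhi J0.
have vE : Num.sqrt (partial_variance b [set: 'I_m]%SET) = S.
  rewrite /partial_variance (eq_bigl xpredT) -?SE ?sqrtr_sqr ?ger0_norm ?ltW//.
  by move=> j; rewrite inE.
have XE w : partial_sum Z b [set: 'I_m]%SET w = \sum_(j < m) (b j)%:C * Z j w.
  by rewrite /partial_sum; apply: eq_bigl => j; rewrite inE.
have [mX iX _ _] := cX.
have ma : measurable_fun setT (cst a : T -> R[i]) by exact: measurable_cst.
under eq_integral do rewrite addrC -XE.
apply: expected_lne_ge => //; first exact: measurable_complexD.
apply: le_trans (isotropic_log_deficitD S0 mX ma iX (independent_cst _ _ _)) _.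
rewrite EFinD leeD2l//; rewrite vE in dX; apply: le_trans dX.
apply: ge0_le_integral => //.
- by move=> w _; exact: log_deficit_ge0.
- apply: (measurableT_comp (measurable_log_deficit S)).
  by apply: measurable_maxr; exact: measurable_normc.
- apply: (measurableT_comp (measurable_log_deficit S)).
  exact: measurable_normc.
- by move=> w _; apply: le_log_deficit; rewrite le_max lexx.
Qed.
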